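(* Let $(E,\mathcal{E})$ be a countably generated measurable space whose diagonal $\Delta=\{(x,x): x\in E\}$ belongs to $\mathcal{E}\otimes\mathcal{E}$, and let $X=(X_n)_{n\in\mathbb{Z}_+}$ be a Markov chain with state space $(E,\mathcal{E})$ and $n$-step transition probabilities $P_n(x,dy)$. Assume that for each $x,y\in E$ there exists $n=n_{x,y}\in\mathbb{N}$ such that $$P_n(x,\cdot)\sim P_n(y,\cdot).$$ Then there exists at most one invariant probability measure for the chain $X$. If an invariant probability measure $\mu$ exists, then for every $x\in E$ $$\|P_n(x,\cdot)-\mu\|\to 0,\quad n\to\infty.$$
   Context: The Markov chain is time-homogeneous in discrete time; $P(x,dy)$ denotes its one-step transition probability (a Markov kernel on $(E,\mathcal{E})$) and $P_n(x,dy)$ its $n$-step transition probability. An invariant probability measure for $X$ is a probability measure $\mu$ on $(E,\mathcal{E})$ with $\mu(dy)=\int_E P(x,dy)\,\mu(dx)$. For probability measures $\nu,\bar\nu$ on $(E,\mathcal{E})$: $\nu\sim\bar\nu$ means they are equivalent, i.e. each is absolutely continuous with respect to the other; $\|\nu-\bar\nu\|$ is the total variation of the signed measure $\nu-\bar\nu$ (so it takes values in $[0,2]$, with value $2$ exactly when $\nu$ and $\bar\nu$ are mutually singular). *)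

(* Defs.v *)
From HB Require Import structures.
From mathcomp Require Import all_boot all_order all_algebra.
From mathcomp Require Import all_classical all_reals all_analysis.

Set Implicit Arguments.
Unset Strict Implicit.
Unset Printing Implicit Defensive.
Import Order.TTheory GRing.Theory Num.Theory.
Import numFieldNormedType.Exports.

Local Open Scope classical_set_scope.
Local Open Scope ring_scope.
Local Open Scope ereal_scope.

Definition countably_generated (d : measure_display) (E : measurableType d) :=
  exists2 G : set (set E), countable G & @measurable d E = <<s G >>.

Section probability_kcomp_noparam.
Context d0 d1 d2 (T0 : measurableType d0) (T1 : measurableType d1)
  (T2 : measurableType d2) (R : realType).
Variables (k1 : R.-pker T0 ~> T1) (k2 : R.-pker T1 ~> T2).

Let prob_mkcomp_noparam x : mkcomp_noparam k1 k2 x [set: T2] = 1.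
Proof.
rewrite /mkcomp_noparam /= /kcomp_noparam.
under eq_integral do rewrite prob_kernel.
by rewrite integral_cst// mul1e prob_kernel.
Qed.

HB.instance Definition _ := isProbabilityKernel.Build _ _ _ _ R
  (mkcomp_noparam k1 k2) prob_mkcomp_noparam.

End probability_kcomp_noparam.

Section markov_chain.
Context d (E : measurableType d) (R : realType).

Fixpoint nstep (P : R.-pker E ~> E) (n : nat) : R.-pker E ~> E :=
  if n is m.+1 then mkcomp_noparam (nstep P m) P
  else kdirac (@measurable_id _ E setT).

Definition invariant_probability (P : R.-pker E ~> E) (mu : probability E R) :=
  forall A, measurable A -> mu A = \int[mu]_x P x A.

(* The library keeps the measure [k x] and the fact that it has mass 1 apart;
   this bundles them. *)
Section pkernel_probability.
Variables (k : R.-pker E ~> E) (x : E).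
Definition pkernel_probability : set E -> \bar R := k x.
HB.instance Definition _ := Measure.on pkernel_probability.
HB.instance Definition _ := Measure_isProbability.Build _ _ _
  pkernel_probability (prob_kernel x).
End pkernel_probability.

Definition nstep_probability (P : R.-pker E ~> E) (n : nat) (x : E) :
  probability E R := pkernel_probability (nstep P n) x.

End markov_chain.

Definition equivalent_measures d (T : measurableType d) (R : realType)
  (nu nu' : {measure set T -> \bar R}) := nu `<< nu' /\ nu' `<< nu.

Section total_variation_norm.
Context d (T : measurableType d) (R : realType).

(* |nu|(T), computed with some Hahn decomposition of nu; by [tv_normE] below
   the choice is immaterial. *)
Definition tv_norm (nu : {charge set T -> \bar R}) : \bar R :=
  charge_variation (svalP (cid (svalP (cid (Hahn_decomposition nu)))))
    [set: T].

Lemma tv_normE (nu : {charge set T -> \bar R}) P N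
    (nuPN : hahn_decomposition nu P N) :
  tv_norm nu = nu P - nu N.
Proof.
rewrite /tv_norm; move: (svalP (cid (svalP (cid (Hahn_decomposition nu))))) => /= nuPN'.
rewrite /charge_variation !jordan_posE !jordan_negE.
rewrite cjordan_posE cjordan_negE /crestr0 mem_set//= /crestr.
have [+ +] := Hahn_decomposition_uniq nuPN nuPN' measurableT.
by rewrite !setTI => -> ->.
Qed.

Definition tv_dist (nu nu' : probability T R) : \bar R :=
  tv_norm (cadd (charge_of_finite_measure nu)
                (copp (charge_of_finite_measure nu'))).

End total_variation_norm.

(* Main.v *)
Require Import Defs.
From mathcomp Require Import all_boot all_order all_algebra.
From mathcomp Require Import all_classical all_reals all_analysis.
From mathcomp Require Import measurable_realfun giry.
From mathcomp Require Import ring lra.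

(** Let [h (x, y)] be the limit of the nonincreasing sequence
    [gap (P_n x) (P_n y)], where [gap] is half of the total variation distance.
    Along two independent copies of the chain [h] is subharmonic; as [mu \x mu]
    is invariant for this product chain and the transition probabilities from
    any two points are eventually equivalent, [h] is constant [mu \x mu]-almost
    everywhere, say equal to [c], and [c < 1]. Removing from [P_n x] and [P_n y]
    their common part leaves two measures of mass [b = gap (P_n x) (P_n y)],
    and running them independently gives [b * c <= c * b ^ 2]; since [b] decreases
    to [c < 1], this forces [c = 0]. Each [P_n x] is eventually dominated by [mu],
    so [h] vanishes everywhere by subharmonicity, and integrating
    [gap (P_n x) (P_n y)] over [mu (dy)] gives the convergence. *)

Set Implicit Arguments.
Unset Strict Implicit.
Unset Printing Implicit Defensive.
Import Order.TTheory GRing.Theory Num.Theory.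
Import numFieldNormedType.Exports.
Local Open Scope classical_set_scope.
Local Open Scope ring_scope.
Local Open Scope ereal_scope.

(** * Countable rings of sets and the monotone class theorem *)

Section countable_ring.
Context {T : Type}.

(** Evaluates finite set expressions built from the sets [F n]. Trees over [nat] form a countable
    type, so the range of this evaluation is a countable ring. *)
Fixpoint ring_term (F : nat -> set T) (t : GenTree.tree nat) : set T :=
  match t with
  | GenTree.Leaf n => F n
  | GenTree.Node 0 [:: s; u] => ring_term F s `|` ring_term F u
  | GenTree.Node 1 [:: s; u] => ring_term F s `\` ring_term F u
  | GenTree.Node 2 [::] => setT
  | _ => set0
  end.

Lemma countable_g_setring (G : set (set T)) :
  countable G -> countable <<r setT |` G>>.
Proof.
move=> cG.
have [F GF] : exists F : nat -> set T, G `<=` range F.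
  have /pfcard_geP[->|[F]] := cG; first by exists (fun=> set0).
  by exists F => A GA; have [n _ <-] := 'surj_F GA; exists n.
apply: (@sub_countable _ _ _ (range (ring_term F))); last first.
  by apply: card_le_trans (card_image_le _ _) _; exact: countableP.
apply: subset_card_le; apply: smallest_sub.
  split; first by exists (GenTree.Node 3 [::]).
  - by move=> _ _ [s _ <-] [t _ <-]; exists (GenTree.Node 0 [:: s; t]).
  - by move=> _ _ [s _ <-] [t _ <-]; exists (GenTree.Node 1 [:: s; t]).
move=> A [->|/GF[n _ <-]]; first by exists (GenTree.Node 2 [::]).
by exists (GenTree.Leaf n).
Qed.

(** The monotone class generated by a ring is a sigma-ring; since it contains the whole space, it is
    closed under complements. *)
Lemma g_sigma_algebra_sub_setring (G : set (set T)) :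
  setring G -> G setT -> <<s G>> `<=` <<M G>>.
Proof.
move=> rG GT; rewrite g_monotone_g_sigma_ring//.
have [R0 RD RU] := @smallest_sigma_ring _ G.
apply: smallest_sub; last exact: sub_smallest.
split=> // A GA; apply: RD => //.
exact: sub_g_sigma_ring.
Qed.

End countable_ring.

(** * The gap of two probability measures as a one-sided supremum *)

Section gap.
Context d (T : measurableType d) (R : realType).
Implicit Types nu : probability T R.

Definition gap (nu nu' : set T -> \bar R) : \bar R :=
  ereal_sup [set nu A - nu' A | A in measurable].

Lemma gap_ge0 (nu nu' : {measure set T -> \bar R}) : 0 <= gap nu nu'.
Proof.
by apply: ereal_sup_ubound; exists set0; rewrite ?measure0 ?sube0.
Qed.

Lemma gap_le nu nu' t :
  (forall A, measurable A -> nu A <= nu' A + t) -> gap nu nu' <= t.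
Proof.
move=> h; apply: ge_ereal_sup => _ [A mA <-].
by rewrite leeBlDl ?fin_num_measure// h.
Qed.

Lemma le_gap nu nu' A : measurable A -> nu A <= nu' A + gap nu nu'.
Proof.
move=> mA; rewrite -leeBlDl ?fin_num_measure//.
by apply: ereal_sup_ubound; exists A.
Qed.

Lemma gap_le1 nu nu' : gap nu nu' <= 1.
Proof.
by apply: gap_le => A mA; rewrite (le_trans (probability_le1 nu mA))// leeDr.
Qed.

Lemma gap_fin_num nu nu' : gap nu nu' \is a fin_num.
Proof.
by rewrite ge0_fin_numE ?gap_ge0// (le_lt_trans (gap_le1 nu nu'))// ltry.
Qed.

(** Both masses are 1, so passing from [A] to its complement changes the sign of the difference. *)
Lemma gapC nu nu' : gap nu nu' = gap nu' nu.
Proof.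
suff le (m m' : probability T R) : gap m m' <= gap m' m.
  by apply/eqP; rewrite eq_le !le.
apply: gap_le => A mA.
have := le_gap m' m (measurableC mA); rewrite !probability_setC//.
have fA (m0 : probability T R) : m0 A \is a fin_num by exact: fin_num_measure.
case: (m A) (m' A) (gap m' m) (fA m) (fA m') (gap_fin_num m' m)
  => [a| |] [b| |]// [c| |]// _ _ _.
by rewrite -!EFinB -!EFinD !lee_fin; lra.
Qed.

(** Serves to compute the gap as a supremum over a countable ring, whence its measurability in
    parameters. The bound [nu A <= nu' A + t] survives monotone limits of sets because both measures
    are finite. *)
Lemma gap_setring (G : set (set T)) nu nu' : setring G -> G setT ->
  @measurable d T = <<s G>> ->
  gap nu nu' = ereal_sup [set nu A - nu' A | A in G].
Proof.
move=> rG GT mG; apply/eqP; rewrite eq_le; apply/andP; split; last first.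
  apply: ereal_sup_le => _ [A GA <-]; exists A => //.
  by rewrite mG; exact: sub_gen_smallest.
have mGA A : G A -> measurable A by rewrite mG; exact: sub_gen_smallest.
set t := ereal_sup _.
have tge A : G A -> nu A <= nu' A + t.
  move=> GA; rewrite -leeBlDl ?fin_num_measure//; last exact: mGA.
  by apply: ereal_sup_ubound; exists A.
have t0 : 0 <= t.
  by apply: ereal_sup_ubound; exists set0; rewrite ?measure0 ?sube0//; case: rG.
have tfin : t \is a fin_num.
  rewrite ge0_fin_numE// (@le_lt_trans _ _ 1) ?ltry//.
  rewrite (le_trans _ (gap_le1 nu nu'))//.
  by apply: ereal_sup_le => _ [A GA <-]; exists A => //; exact: mGA.
apply: gap_le => A; rewrite mG => /(g_sigma_algebra_sub_setring rG GT) => MA.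
pose K := [set A | measurable A /\ nu A <= nu' A + t].
suff: <<M G>> `<=` K by move=> /(_ _ MA)[].
apply: smallest_sub; last by move=> B GB; split; [exact: mGA|exact: tge].
have tdef (m : probability T R) B : m B +? t by rewrite fin_num_adde_defl.
split=> F mF KF.
- have mUF : measurable (\bigcup_i F i).
    by apply: bigcup_measurable => i _; have [] := KF i.
  split=> //.
  have mFi i : measurable (F i) by have [] := KF i.
  have c1 := nondecreasing_cvg_mu (mu := nu) mFi mUF mF.
  have c2 := nondecreasing_cvg_mu (mu := nu') mFi mUF mF.
  apply: (lee_cvg_to c1); first by apply: cvgeD; [|exact: c2|exact: cvg_cst].
  by apply: nearW => i; have [] := KF i.
- have mIF : measurable (\bigcap_i F i).
    by apply: bigcap_measurable => // i _; have [] := KF i.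
  split=> //.
  have mFi i : measurable (F i) by have [] := KF i.
  have mu0 (m : probability T R) : m (F 0%N) < +oo by rewrite ltey_eq fin_num_measure.
  have c1 := nonincreasing_cvg_mu (mu0 nu) mFi mIF mF.
  have c2 := nonincreasing_cvg_mu (mu0 nu') mFi mIF mF.
  apply: (lee_cvg_to c1).
    by apply: cvgeD; [|exact: c2|exact: cvg_cst].
  by apply: nearW => i; have [] := KF i.
Qed.

End gap.

(** * Hahn and Jordan decompositions of a difference *)

Section gap_jordan.
Context d (T : measurableType d) (R : realType).
Implicit Types nu : probability T R.

Let eqB_eqD (a b u v : \bar R) : a \is a fin_num -> b \is a fin_num ->
  u \is a fin_num -> v \is a fin_num -> a - b = u - v -> a + v = b + u.
Proof.
move: a b u v => [a| |] [b| |] [u| |] [v| |] // _ _ _ _ [ab].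
by rewrite -!EFinD; congr EFin; move: ab; lra.
Qed.

Let diff nu nu' : {charge set T -> \bar R} :=
  cadd (charge_of_finite_measure nu) (copp (charge_of_finite_measure nu')).

Let diffE nu nu' A : diff nu nu' A = nu A - nu' A.
Proof. by []. Qed.

(** Dropping the part of [A] inside the negative set [N], then adding the rest of [H], can only
    increase the difference. *)
Let gap_hahn nu nu' H N : hahn_decomposition (diff nu nu') H N ->
  gap nu nu' = nu H - nu' H.
Proof.
move=> nuHN; have [[mH posH] [mN negN] HNT HN0] := nuHN.
apply/eqP; rewrite eq_le; apply/andP; split; last first.
  by apply: ereal_sup_ubound; exists H.
apply: ge_ereal_sup => _ [A mA <-]; rewrite -!diffE.
apply: (@le_trans _ _ (diff nu nu' (A `&` H))).
  rewrite (charge_partition (diff nu nu') mA mH mN)//.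
  by rewrite geeDl// negN//; exact: measurableI.
rewrite [leRHS](_ : _ = diff nu nu' (A `&` H) + diff nu nu' (H `\` A)); last first.
  by rewrite (chargeDI (diff nu nu') mH mA) addeC setIC.
by rewrite leeDl// posH//; exact: measurableD.
Qed.

Lemma gap_attained nu nu' :
  exists2 H, measurable H & gap nu nu' = nu H - nu' H.
Proof.
have [H [N nuHN]] := Hahn_decomposition (diff nu nu').
by exists H; [have [[]] := nuHN|exact: gap_hahn nuHN].
Qed.

(** [p] and [q] are the positive and negative parts of [nu - nu'], that is, what remains of [nu] and
    [nu'] once their common part is removed. The additive form of the identity avoids subtraction in
    [\bar R]. *)
Lemma gap_jordan nu nu' : exists p q : {finite_measure set T -> \bar R},
  [/\ forall A, measurable A -> nu A + q A = nu' A + p A,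
    p `<< nu, q `<< nu', p setT = gap nu nu' & q setT = gap nu nu'].
Proof.
have [H [N nuHN]] := Hahn_decomposition (diff nu nu').
have [[mH _] [mN _] _ _] := nuHN.
have pE A : measurable A -> jordan_pos nuHN A = nu (A `&` H) - nu' (A `&` H).
  by move=> mA; rewrite jordan_posE cjordan_posE /crestr0 mem_set.
have qE A : measurable A -> jordan_neg nuHN A = - (nu (A `&` N) - nu' (A `&` N)).
  by move=> mA; rewrite jordan_negE cjordan_negE /crestr0 mem_set.
have pqE A : measurable A -> nu A + jordan_neg nuHN A = nu' A + jordan_pos nuHN A.
  move=> mA.
  have : nu A - nu' A = jordan_pos nuHN A - jordan_neg nuHN A.
    by rewrite -diffE (jordan_decomp nuHN mA) /cadd/= cscaleN1.
  apply: eqB_eqD; first [exact: fin_num_measure|exact: (fin_num_measure (jordan_pos nuHN))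
    |exact: (fin_num_measure (jordan_neg nuHN))].
have pT : jordan_pos nuHN setT = gap nu nu' by rewrite pE// !setTI (gap_hahn nuHN).
have p_nu A : measurable A -> nu A = 0 -> jordan_pos nuHN A = 0.
  move=> mA nuA0; apply/eqP; rewrite eq_le measure_ge0 andbT pE//.
  rewrite (subset_measure0 _ mA _ nuA0)//; last exact: measurableI.
  by rewrite sub0e leeNl oppe0.
have q_nu' A : measurable A -> nu' A = 0 -> jordan_neg nuHN A = 0.
  move=> mA nuA0; apply/eqP; rewrite eq_le measure_ge0 andbT qE//.
  rewrite (subset_measure0 _ mA _ nuA0)//; last exact: measurableI.
  by rewrite sube0 leeNl oppe0.
exists (jordan_pos nuHN), (jordan_neg nuHN); split => //.
- exact/null_content_dominatesP.
- exact/null_content_dominatesP.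
- have := pqE setT measurableT; rewrite !probability_setT pT.
  move=> /(congr1 (fun t => t - 1)).
  by rewrite ![1 + _]addeC !addeK.
Qed.

(** The supremum is attained: a gap of 1 would give a set [H] with [nu H = 1] and [nu' H = 0]. *)
Lemma gap_lt1 nu nu' : nu `<< nu' -> gap nu nu' < 1.
Proof.
move=> /null_content_dominatesP dom.
rewrite lt_neqAle gap_le1 andbT; apply/eqP => gap1.
have [H mH] := gap_attained nu nu'; rewrite gap1.
have : nu H <= 1 by exact: probability_le1.
have : 0 <= nu' H by [].
have : nu' H = 0 -> nu H = 0 by exact: dom.
case: (nu H) (nu' H) (fin_num_measure nu H mH) (fin_num_measure nu' H mH)
  => [a| |] [b| |] // _ _.
rewrite !lee_fin => h b0 a1 [ab].
have b0' : b = 0%R by lra.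
by have [a0] := h (congr1 EFin b0'); clear -ab a0 b0'; lra.
Qed.

Lemma tv_dist_gap nu nu' : tv_dist nu nu' = 2%:E * gap nu nu'.
Proof.
have [H [N nuHN]] := Hahn_decomposition (diff nu nu').
rewrite /tv_dist (tv_normE nuHN) (gap_hahn nuHN).
have [[mH _] [mN _] HNT HN0] := nuHN.
rewrite -/(diff nu nu') !diffE.
have NE (m : probability T R) : m N = 1 - m H.
  rewrite -(probability_setT m) -HNT measureU// addeAC subee ?add0e//.
  by rewrite fin_num_measure.
have fH (m : probability T R) : m H \is a fin_num by exact: fin_num_measure.
rewrite !NE; case: (nu H) (nu' H) (fH nu) (fH nu') => [a| |] [b| |] // _ _.
transitivity ((a - b - ((1 - a) - (1 - b)))%:E) => //.
by rewrite -EFinB -EFinM; congr EFin; ring.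
Qed.

End gap_jordan.

(** * Null sets, bounded integrands and mixtures of measures *)

Lemma integral_probability_cst d (T : measurableType d) (R : realType)
  (nu : probability T R) (a : R) : \int[nu]_x a%:E = a%:E.
Proof.
rewrite integral_cst// -[RHS]mule1; congr (_ * _); exact: probability_setT.
Qed.

Section almost_everywhere.
Context d (T : measurableType d) (R : realType).
Implicit Types m nu : {measure set T -> \bar R}.

Lemma ge0_integral_eq0P m (g : T -> \bar R) :
  measurable_fun [set: T] g -> (forall x, 0 <= g x) ->
  \int[m]_x g x = 0 <-> {ae m, forall x, g x = 0}.
Proof.
move=> mg g0.
rewrite (_ : \int[m]_x g x = \int[m]_x `|g x|); last first.
  by apply: eq_integral => x _; rewrite gee0_abs.
rewrite (ae_eq_integral_abs _ measurableT mg).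
by split; apply: filterS => x // /(_ I).
Qed.

Lemma null_dominates_ae m nu (P : T -> Prop) :
  m `<< nu -> {ae nu, forall x, P x} -> {ae m, forall x, P x}.
Proof.
move=> /null_content_dominatesP dom [N [mN N0 PN]].
by exists N; split => //; exact: dom.
Qed.

Lemma ae_probability_ex (m : probability T R) (P : T -> Prop) :
  {ae m, forall x, P x} -> exists x, P x.
Proof.
move=> [N [mN N0 PN]]; apply: contrapT => /forallNP nP.
suff: m [set: T] = 0 by rewrite probability_setT => -[] /eqP; rewrite oner_eq0.
by apply: subset_measure0 N0 => // x _; apply: PN => /=; exact: nP.
Qed.

Lemma integral_le1_fin_num (m : {finite_measure set T -> \bar R}) (g : T -> \bar R) :
  measurable_fun [set: T] g -> (forall x, 0 <= g x <= 1) ->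
  \int[m]_x g x \is a fin_num.
Proof.
move=> mg g01; rewrite ge0_fin_numE; last first.
  by apply: integral_ge0 => z _; case/andP: (g01 z).
apply: (@le_lt_trans _ _ (\int[m]_z 1)).
  by apply: ge0_le_integral => // x _; case/andP: (g01 x).
by rewrite integral_cst// mul1e ltey_eq fin_num_measure.
Qed.

End almost_everywhere.

Section mixture.
Context d d' (X : measurableType d) (Y : measurableType d') (R : realType).
Variables (m : probability X R) (k : X -> probability Y R).
Hypothesis mk : forall A, measurable A -> measurable_fun [set: X] (k ^~ A).

Lemma measurable_integral_family (f : Y -> \bar R) :
  measurable_fun setT f -> (forall y, 0 <= f y) ->
  measurable_fun setT (fun x => \int[k x]_y f y).
Proof.
by move=> mf f0; exact: (measurable_fun_integral_kernel
  (l := fun x => k x : {measure set Y -> \bar R})).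
Qed.

(** [m'] agrees on measurable sets with the bind of [m] and [k] in the Giry monad, for which the
    formula is known. *)
Lemma ge0_integral_mixture (m' : {measure set Y -> \bar R}) (f : Y -> \bar R) :
  (forall A, measurable A -> m' A = \int[m]_x k x A) ->
  measurable_fun setT f -> (forall y, 0 <= f y) ->
  \int[m']_y f y = \int[m]_x \int[k x]_y f y.
Proof.
move=> m'E mf f0.
pose k' x : giry Y R := k x.
have mk' : measurable_fun [set: X] k' by exact: measurable_giry_codensity.
have := giry_int_bind (m : giry X R) mk' mf f0; rewrite /giry_int => <-.
apply: eq_measure_integral => A mA _; rewrite m'E//.
by rewrite /giry_bind/= giry_int_map//; exact: measurable_giry_ev.
Qed.

End mixture.

(** * Bounded subharmonic functions under an invariant measure *)

Section subharmonic.
Context d (Z : measurableType d) (R : realType).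
Implicit Types (m : probability Z R) (f : Z -> R).

(* [\int\int (f w - f z)^2 Q(z,dw) m(dz) = 2 \int f^2 dm - 2 \int f (Q f) dm], and
   the right-hand side is nonpositive when [f <= Q f]. *)
Lemma subharmonic_invariant_ae m (Q : Z -> probability Z R) f :
  (forall A, measurable A -> measurable_fun [set: Z] (Q ^~ A)) ->
  (forall A, measurable A -> m A = \int[m]_z Q z A) ->
  measurable_fun setT f -> (forall z, (0 <= f z <= 1)%R) ->
  (forall z, (f z)%:E <= \int[Q z]_w (f w)%:E) ->
  {ae m, forall z, {ae Q z, forall w, f w = f z}}.
Proof.
move=> mQ Qm mf f01 fQ.
have f0 z : (0 <= f z)%R by case/andP: (f01 z).
have f1 z : (f z <= 1)%R by case/andP: (f01 z).
have mf2 : measurable_fun setT (fun w => (f w ^+ 2)%R) by exact: measurable_funX.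
have mfB z : measurable_fun setT (fun w => ((f w - f z) ^+ 2)%R).
  by apply: measurable_funX; exact: measurable_funB.
have f201 z : (0 <= f z ^+ 2 <= 1)%R by rewrite sqr_ge0 exprn_ile1.
pose V z := \int[Q z]_w ((f w - f z) ^+ 2)%:E.
pose Q1 z := \int[Q z]_w (f w)%:E.
pose Q2 z := \int[Q z]_w (f w ^+ 2)%:E.
have Q1fin z : Q1 z \is a fin_num.
  apply: integral_le1_fin_num => [|w]; first exact/measurable_EFinP.
  by rewrite !lee_fin f01.
have V0 z : 0 <= V z by apply: integral_ge0 => w _; rewrite lee_fin sqr_ge0.
(* Expansion of the square, with the cross term moved to the left so that every integrand is
   nonnegative. *)
have VE z : V z + (2 * f z)%:E * Q1 z = Q2 z + (f z ^+ 2)%:E.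
  rewrite -ge0_integralZl//; last 3 first.
  - exact/measurable_EFinP.
  - by move=> w _; rewrite lee_fin.
  - by rewrite lee_fin mulr_ge0.
  rewrite -[X in _ + X = _]/(\int[Q z]_w _) -ge0_integralD//; last 4 first.
  - by move=> w _; rewrite lee_fin sqr_ge0.
  - exact/measurable_EFinP.
  - by move=> w _; rewrite -EFinM lee_fin !mulr_ge0.
  - by apply: measurable_funeM; exact/measurable_EFinP.
  have -> : (f z ^+ 2)%:E = \int[Q z]_w (f z ^+ 2)%:E.
    by rewrite integral_probability_cst.
  rewrite -ge0_integralD//; last 3 first.
  - by move=> w _; rewrite lee_fin sqr_ge0.
  - exact/measurable_EFinP.
  - by move=> w _; rewrite lee_fin sqr_ge0.
  apply: eq_integral => w _; rewrite -EFinM -!EFinD; congr EFin; ring.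
have VE' z : V z = Q2 z + (f z ^+ 2)%:E - (2 * f z)%:E * Q1 z.
  by rewrite -VE addeK// fin_numM.
have mQ1 : measurable_fun setT Q1.
  by apply: measurable_integral_family => //; exact/measurable_EFinP.
have mQ2 : measurable_fun setT Q2.
  apply: measurable_integral_family => //; first exact/measurable_EFinP.
  by move=> z; rewrite lee_fin sqr_ge0.
have mV : measurable_fun setT V.
  apply: (eq_measurable_fun (fun z => Q2 z + (f z ^+ 2)%:E - (2 * f z)%:E * Q1 z)).
    by move=> z _; rewrite VE'.
  apply: emeasurable_funB.
    by apply: emeasurable_funD => //; exact/measurable_EFinP.
  apply: emeasurable_funM => //; apply/measurable_EFinP.
  exact: measurable_funM.
(* By [VE] this amounts to [2 * f z ^+ 2 <= 2 * f z * Q1 z], which is [fQ] multiplied by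
   [2 * f z >= 0]. *)
have VQ2 z : V z + (f z ^+ 2)%:E <= Q2 z.
  rewrite -(leeD2rE _ _ (isT : (f z ^+ 2)%:E \is a fin_num)) -VE -addeA leeD2l//.
  rewrite -EFinD (_ : (_ + _)%R = (2 * f z * f z)%R); last by ring.
  by rewrite EFinM lee_wpmul2l// lee_fin mulr_ge0.
(* Integrate [VQ2]: by invariance [Q2] and [f ^+ 2] have the same finite integral, which cancels. *)
have IV : \int[m]_z V z = 0.
  apply/eqP; rewrite eq_le integral_ge0 ?andbT//.
  have fI : \int[m]_z (f z ^+ 2)%:E \is a fin_num.
    apply: integral_le1_fin_num => [|w]; first exact/measurable_EFinP.
    by rewrite !lee_fin f201.
  rewrite -(leeD2rE _ _ fI) add0e -ge0_integralD//; last 2 first.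
  - by move=> w _; rewrite lee_fin sqr_ge0.
  - exact/measurable_EFinP.
  rewrite [leRHS](ge0_integral_mixture mQ Qm)//; last 2 first.
  - exact/measurable_EFinP.
  - by move=> w; rewrite lee_fin sqr_ge0.
  apply: ge0_le_integral => //.
  - by move=> z _; rewrite adde_ge0// lee_fin sqr_ge0.
  - by apply: emeasurable_funD => //; exact/measurable_EFinP.
apply: filterS ((ge0_integral_eq0P m mV V0).1 IV) => z.
move=> /ge0_integral_eq0P Vz0; apply: filterS (Vz0 _ _) => [w []/eqP| |w].
- by rewrite expf_eq0/= subr_eq0 => /eqP.
- exact/measurable_EFinP.
- by rewrite lee_fin sqr_ge0.
Qed.

(** At almost every [z], the function [f] is [Q n z]-almost surely equal to [f z] for all [n] at
    once. For two such points, absolute continuity at a suitable [n] makes both almost sure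
    statements hold under one probability measure, so the two values coincide. *)
Lemma subharmonic_ae_cst m (Q : nat -> Z -> probability Z R) f :
  (forall n A, measurable A -> measurable_fun [set: Z] (Q n ^~ A)) ->
  (forall n A, measurable A -> m A = \int[m]_z Q n z A) ->
  (forall z1 z2, exists n, Q n z1 `<< Q n z2) ->
  measurable_fun setT f -> (forall z, (0 <= f z <= 1)%R) ->
  (forall n z, (f z)%:E <= \int[Q n z]_w (f w)%:E) ->
  exists z0, {ae m, forall z, f z = f z0} /\
    forall n, {ae Q n z0, forall w, f w = f z0}.
Proof.
move=> mQ Qm Qac mf f01 fQ.
have good : {ae m, forall z, forall n, {ae Q n z, forall w, f w = f z}}.
  apply: ae_foralln => n.
  exact: (subharmonic_invariant_ae (mQ n) (Qm n) mf f01 (fQ n)).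
have [z0 z0P] := ae_probability_ex good.
exists z0; split => //.
apply: filterS good => z zP.
have [n Qn] := Qac z0 z.
(* Both equalities hold [Q n z0]-almost surely, hence at some common point [w]. *)
have [w [<- //]] : exists w, f w = f z /\ f w = f z0.
apply: (@ae_probability_ex _ _ _ (Q n z0)).
apply: filterI; last exact: z0P.
by apply: null_dominates_ae Qn _; exact: zP.
Qed.

End subharmonic.

(** * Product measures *)

Section products.
Context d d' (X : measurableType d) (Y : measurableType d') (R : realType).

Lemma integral_product_fst (p : {finite_measure set X -> \bar R})
    (q : {finite_measure set Y -> \bar R}) (g : X -> \bar R) :
  measurable_fun [set: X] g -> (forall x, 0 <= g x) ->
  \int[p \x q]_z g z.1 = q setT * \int[p]_x g x.
Proof.
move=> mg g0.
rewrite (@fubini_tonelli1 _ _ _ _ _ _ _ (fun z => g z.1))//; last first.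
  exact: measurableT_comp.
rewrite -ge0_integralZl//; apply: eq_integral => x _.
by rewrite /fubini_F/= integral_cst// muleC.
Qed.

Lemma integral_product_snd (p : {finite_measure set X -> \bar R})
    (q : {finite_measure set Y -> \bar R}) (g : Y -> \bar R) :
  measurable_fun [set: Y] g -> (forall y, 0 <= g y) ->
  \int[p \x q]_z g z.2 = p setT * \int[q]_y g y.
Proof.
move=> mg g0.
rewrite (@fubini_tonelli2 _ _ _ _ _ _ _ (fun z => g z.2))//; last first.
  exact: measurableT_comp.
rewrite -ge0_integralZl//; apply: eq_integral => y _.
by rewrite /fubini_G/= integral_cst// muleC.
Qed.

(** Almost every section of a null set is null, first for the dominating measures and then for the
    dominated ones. *)
Lemma product_dominates (nu1 nu1' : {measure set X -> \bar R})
    (nu2 nu2' : {sigma_finite_measure set Y -> \bar R}) :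
  nu1 `<< nu1' -> nu2 `<< nu2' -> nu1 \x nu2 `<< nu1' \x nu2'.
Proof.
move=> dom1 /null_content_dominatesP dom2.
apply/null_content_dominatesP => A mA.
have mx (nu : {sigma_finite_measure set Y -> \bar R}) :
    measurable_fun [set: X] (nu \o xsection A) by exact: measurable_fun_xsection.
move=> /(ge0_integral_eq0P _ (mx nu2') _) i0.
apply/(ge0_integral_eq0P _ (mx nu2)) => //.
apply: filterS (null_dominates_ae dom1 (i0 _)) => // x /= xA.
by apply: dom2 => //; exact: measurable_xsection.
Qed.

End products.

(** * The gap as a bound on integrals *)

Section gap_integral.
Context d (T : measurableType d) (R : realType).
Implicit Types (nu : probability T R).

Lemma integral_measure_eqD (m1 m2 m3 m4 : {measure set T -> \bar R}) (g : T -> \bar R) :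
  (forall A, measurable A -> m1 A + m2 A = m3 A + m4 A) ->
  measurable_fun [set: T] g -> (forall x, 0 <= g x) ->
  \int[m1]_x g x + \int[m2]_x g x = \int[m3]_x g x + \int[m4]_x g x.
Proof.
move=> mE mg g0; rewrite -!ge0_integral_measure_add//.
apply: eq_measure_integral => A mA _.
by have := mE A mA; rewrite -!measure_addE.
Qed.

(** By [gap_jordan] the two integrals differ by at most the integral of [g] over [p], which is at
    most the mass of [p]. *)
Lemma le_integral_gap nu nu' (g : T -> \bar R) : measurable_fun [set: T] g ->
  (forall x, 0 <= g x <= 1) ->
  \int[nu]_x g x <= \int[nu']_x g x + gap nu nu'.
Proof.
move=> mg g01.
have g0 x : 0 <= g x by case/andP: (g01 x).
have [p [q [pq _ _ pT _]]] := gap_jordan nu nu'.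
apply: (@le_trans _ _ (\int[nu]_x g x + \int[q]_x g x)).
  by rewrite leeDl// integral_ge0.
rewrite (integral_measure_eqD pq mg g0) leeD2l// -pT -[leRHS]mul1e.
rewrite -integral_cst//; apply: ge0_le_integral => //.
by move=> x _; case/andP: (g01 x).
Qed.

End gap_integral.

(** * Iterated transitions and two independent copies of the chain *)

Section chain.
Context d (E : measurableType d) (R : realType) (P : R.-pker E ~> E).

Local Notation p := (nstep_probability P).

Lemma measurable_nstep n A : measurable A ->
  measurable_fun [set: E] ((p n) ^~ A).
Proof. by move=> mA; exact: (measurable_kernel (nstep P n) A mA). Qed.

(** The Chapman-Kolmogorov equation. *)
Lemma nstepD m n x A : measurable A ->
  p (m + n) x A = \int[p m x]_y p n y A.
Proof.
elim: n A => [|n IHn] A mA.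
  rewrite addn0 [RHS](_ : _ = \int[p m x]_y (\1_A y)%:E).
    by rewrite integral_indic// setIT.
  by apply: eq_integral => y _.
rewrite addnS; transitivity (\int[p (m + n) x]_y P y A) => //.
rewrite (ge0_integral_mixture (@measurable_nstep n) (m := p m x) (IHn))//.
exact: (measurable_kernel P A mA).
Qed.

Lemma invariant_nstep (mu : probability E R) n A :
  invariant_probability P mu -> measurable A ->
  mu A = \int[mu]_x p n x A.
Proof.
move=> inv; elim: n A => [|n IHn] A mA.
  rewrite [RHS](_ : _ = \int[mu]_y (\1_A y)%:E).
    by rewrite integral_indic// setIT.
  by apply: eq_integral => y _.
rewrite inv// (ge0_integral_mixture (@measurable_nstep n) IHn)//.
exact: (measurable_kernel P A mA).
Qed.

(** By Chapman-Kolmogorov, [A] is null for [p n x] exactly when [p (n - m) z A] vanishes for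
    [p m x]-almost every [z]. Domination thus persists at later times, which lets different pairs of
    points share one time. *)
Lemma nstep_dominates_le m n x y : (m <= n)%N -> p m x `<< p m y ->
  p n x `<< p n y.
Proof.
move=> /subnKC <- dom; apply/null_content_dominatesP => A mA.
move=> A0; have : \int[p m y]_z p (n - m) z A = 0 by rewrite -nstepD.
move=> /(ge0_integral_eq0P _ (measurable_nstep _ mA)) i0.
transitivity (\int[p m x]_z p (n - m) z A); first by rewrite -nstepD.
apply/(ge0_integral_eq0P _ (measurable_nstep _ mA)) => //.
by apply: (null_dominates_ae dom); exact: i0.
Qed.

Lemma invariant_dominates_le (mu : probability E R) m n x : (m <= n)%N ->
  invariant_probability P mu -> p m x `<< mu -> p n x `<< mu.
Proof.
move=> /subnKC <- inv dom; apply/null_content_dominatesP => A mA.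
move=> A0; have : \int[mu]_z p (n - m) z A = 0 by rewrite -invariant_nstep.
move=> /(ge0_integral_eq0P _ (measurable_nstep _ mA)) i0.
transitivity (\int[p m x]_z p (n - m) z A); first by rewrite -nstepD.
apply/(ge0_integral_eq0P _ (measurable_nstep _ mA)) => //.
by apply: (null_dominates_ae dom); exact: i0.
Qed.

(** A family of probability measures, the form required by the subharmonic lemmas;
    [measurable_nstep2] adds measurability in [z]. *)
Definition nstep2 n (z : E * E) : probability (E * E)%type R :=
  p n z.1 \x p n z.2.

Lemma measurable_nstep2 n A : measurable A ->
  measurable_fun [set: E * E] ((nstep2 n) ^~ A).
Proof.
move=> mA.
pose k z : giry E R * giry E R := (p n z.1 : giry E R, p n z.2 : giry E R).
have mp : measurable_fun [set: E] (fun x => p n x : giry E R).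
  by apply: measurable_giry_codensity => // B mB; exact: measurable_nstep.
have mk : measurable_fun [set: E * E] k.
  by apply: measurable_fun_pair; exact: (measurableT_comp mp).
exact: (measurableT_comp (measurable_giry_ev mA) (measurableT_comp measurable_giry_prod mk)).
Qed.

Lemma invariant_nstep2 (mu : probability E R) n A :
  invariant_probability P mu -> measurable A ->
  (mu \x mu) A = \int[mu \x mu]_z nstep2 n z A.
Proof.
move=> inv mA.
have mq : measurable_fun [set: E * E] (fun z => nstep2 n z : giry (E * E)%type R).
  by apply: measurable_giry_codensity => // B mB; exact: measurable_nstep2.
pose m2 : probability (E * E)%type R := mu \x mu.
have bindE B : measurable B ->
    giry_bind (m2 : giry _ R) mq B = \int[mu \x mu]_z nstep2 n z B.
  by move=> mB; rewrite /giry_bind/= giry_int_map//; exact: measurable_giry_ev.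
(* It is enough to check rectangles, on which the integrand factors and Tonelli reduces the claim to
   invariance of [mu] in each coordinate. *)
rewrite -bindE//; apply: product_measure_unique => // B C mB mC.
transitivity (\int[mu \x mu]_z (p n z.1 B * p n z.2 C)).
  rewrite [LHS]bindE; last exact: measurableX.
  by apply: eq_integral => z _; rewrite [LHS]product_measure1E.
have mpB := measurable_nstep n mB.
have mpC := measurable_nstep n mC.
rewrite (@fubini_tonelli1 _ _ _ _ _ _ _ (fun z => p n z.1 B * p n z.2 C))//; last 2 first.
- by apply: emeasurable_funM; [exact: (measurableT_comp mpB)|exact: (measurableT_comp mpC)].
- by move=> z; exact: mule_ge0.
rewrite /fubini_F/=.
under eq_integral do rewrite ge0_integralZl// -(invariant_nstep n inv mC).
by rewrite ge0_integralZr// -(invariant_nstep n inv mB).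
Qed.

End chain.

(** * The limiting gap: measurability and subharmonicity *)

Section nstep_gap.
Context d (E : measurableType d) (R : realType) (P : R.-pker E ~> E).
Hypothesis hE : countably_generated E.

Local Notation p := (nstep_probability P).

Definition nstep_gap n (z : E * E) : \bar R := gap (p n z.1) (p n z.2).
Local Notation D := nstep_gap.

(** A countable ring generates the sigma-algebra, so by [gap_setring] the gap is a countable
    supremum of measurable functions. *)
Lemma measurable_nstep_gap n : measurable_fun [set: E * E] (D n).
Proof.
have [G0 cG0 mE] := hE.
pose G := <<r setT |` G0>>.
have rG : setring G by exact: smallest_setring.
have GT : G setT by apply: sub_setring; left.
have mG : @measurable d E = <<s G>>.
  rewrite mE; apply/seteqP; split; apply: smallest_sub.
  - exact: smallest_sigma_algebra.
  - by move=> A GA; apply: sub_gen_smallest; apply: sub_setring; right.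
  - exact: smallest_sigma_algebra.
  - rewrite -mE; apply: smallest_sub.
      split; [exact: measurable0|by move=> A B; exact: measurableU|].
      by move=> A B; exact: measurableD.
    by move=> A [->|GA]; [exact: measurableT|rewrite mE; exact: sub_gen_smallest].
have cG : countable G by exact: countable_g_setring.
have /pfcard_geP[G_0|[F]] := cG; first by rewrite G_0 in GT.
have GF i : G (F i) by exact: ('funS_F I).
have mF i : measurable (F i) by rewrite mG; exact: sub_gen_smallest.
rewrite (_ : D n = fun z => esups (fun i => p n z.1 (F i) - p n z.2 (F i)) 0%N).
  apply: (measurable_fun_esups (f := fun i z => p n z.1 (F i) - p n z.2 (F i))).
  move=> i; have mp := measurable_nstep P n (mF i).
  by apply: emeasurable_funB; [exact: (measurableT_comp mp)|exact: (measurableT_comp mp)].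
apply/funext => z; rewrite /D (gap_setring _ _ rG GT mG) /esups/=; congr ereal_sup.
apply/seteqP; split => [_ [A GA <-]|_ [i _ <-]].
  by have [i _ <-] := 'surj_F GA; exists i.
by exists (F i).
Qed.

Lemma nstep_gap01 n z : 0 <= D n z <= 1.
Proof. by rewrite gap_ge0 gap_le1. Qed.

Lemma nonincreasing_nstep_gap z : nonincreasing_seq (D ^~ z).
Proof.
apply/nonincreasing_seqP => n; apply: gap_le => A mA.
(* One more step integrates the [[0, 1]]-valued function [p 1 y A], which cannot widen the gap. *)
rewrite -[in leLHS](addn1 n) -[in leRHS](addn1 n) !nstepD//.
apply: le_integral_gap; first exact: measurable_nstep.
by move=> x; rewrite measure_ge0 probability_le1.
Qed.

Definition limit_gap z := ereal_inf (range (D ^~ z)).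
Local Notation h := limit_gap.

Lemma cvg_nstep_gap z : D n z @[n --> \oo] --> h z.
Proof. exact: ereal_nonincreasing_cvgn (nonincreasing_nstep_gap z). Qed.

Lemma limit_gap_le n z : h z <= D n z.
Proof. by apply: ereal_inf_lbound; exists n. Qed.

Lemma limit_gap01 z : 0 <= h z <= 1.
Proof.
rewrite (le_trans (limit_gap_le 0 z))/= ?andbT; last by case/andP: (nstep_gap01 0 z).
by apply: le_ereal_inf_tmp => _ [n _ <-]; case/andP: (nstep_gap01 n z).
Qed.

Lemma measurable_limit_gap : measurable_fun [set: E * E] h.
Proof.
apply: (emeasurable_fun_cvg D) => [n|z _]; last exact: cvg_nstep_gap.
exact: measurable_nstep_gap.
Qed.

Lemma cvg_integral_nstep_gap (m : {measure set (E * E)%type -> \bar R}) :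
  m setT < +oo -> \int[m]_z D n z @[n --> \oo] --> \int[m]_z h z.
Proof.
move=> mT; apply: (@dominated_cvg _ _ _ m _ measurableT D h (cst 1)) => //.
- exact: measurable_nstep_gap.
- by move=> z _; exact: cvg_nstep_gap.
- apply/integrableP; split=> //.
  under eq_integral do rewrite gee0_abs//.
  by rewrite integral_cst// mul1e.
- by move=> n z _; case/andP: (nstep_gap01 n z) => D0 D1; rewrite gee0_abs.
Qed.

(** Integrate [p k x A <= p k y A + D k (x, y)] over [pp \x qq]. General finite measures are allowed
    so that the residual parts of the two laws may be used. *)
Lemma le_integral_nstep_gap (pp qq : {finite_measure set E -> \bar R}) k A :
  measurable A ->
  qq setT * \int[pp]_x p k x A <=
  pp setT * \int[qq]_y p k y A + \int[pp \x qq]_z D k z.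
Proof.
move=> mA; have mp := measurable_nstep P k mA.
rewrite -(integral_product_fst pp qq mp)// -(integral_product_snd pp qq mp)//.
have mp2 : measurable_fun [set: E * E] (fun z => p k z.2 A).
  exact: (measurableT_comp mp).
have mD := measurable_nstep_gap k.
rewrite -ge0_integralD//; last by move=> z _; case/andP: (nstep_gap01 k z).
apply: ge0_le_integral => //.
- exact: (measurableT_comp mp).
- exact: emeasurable_funD.
- by move=> z _; exact: le_gap.
Qed.

Lemma nstep_gap_subharmonic n k z : D (n + k) z <= \int[nstep2 P n z]_w D k w.
Proof.
apply: gap_le => A mA; rewrite !nstepD//.
have := le_integral_nstep_gap (p n z.1) (p n z.2) k mA.
have pT x : (p n x : {finite_measure set E -> \bar R}) setT = 1.
  exact: probability_setT.
by rewrite !pT !mul1e.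
Qed.

Lemma limit_gap_subharmonic n z : h z <= \int[nstep2 P n z]_w h w.
Proof.
apply: (cvge_ge _ (@cvg_integral_nstep_gap (nstep2 P n z) _)).
  by apply: nearW => k; exact:
    le_trans (limit_gap_le (n + k) z) (nstep_gap_subharmonic n k z).
by rewrite ltey_eq fin_num_measure.
Qed.

End nstep_gap.

(** * Vanishing of the limiting gap and convergence *)

Section doob.
Context d (E : measurableType d) (R : realType) (P : R.-pker E ~> E).
Hypothesis hE : countably_generated E.
Hypothesis hP : forall x y : E, exists n : nat, (0 < n)%N /\
  equivalent_measures (nstep P n x) (nstep P n y).

Local Notation p := (nstep_probability P).
Local Notation D := (nstep_gap P).
Local Notation h := (limit_gap P).

Lemma nstep_eventually_dominates x y :
  exists n, forall m, (n <= m)%N -> p m x `<< p m y.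
Proof.
have [n [_ [dom _]]] := hP x y; exists n => m nm.
exact: nstep_dominates_le nm dom.
Qed.

Lemma limit_gap_lt1 z : h z < 1.
Proof.
have [n dom] := nstep_eventually_dominates z.1 z.2.
exact: le_lt_trans (limit_gap_le P n z) (gap_lt1 (dom n (leqnn n))).
Qed.

Lemma limit_gap_fin_num z : h z \is a fin_num.
Proof.
have /andP[h0 _] := limit_gap01 P z.
by rewrite ge0_fin_numE// (lt_trans (limit_gap_lt1 z))// ltry.
Qed.

Lemma nstep2_dominates z1 z2 : exists n, nstep2 P n z1 `<< nstep2 P n z2.
Proof.
have [n1 dom1] := nstep_eventually_dominates z1.1 z2.1.
have [n2 dom2] := nstep_eventually_dominates z1.2 z2.2.
exists (maxn n1 n2); apply: product_dominates.
  by apply: dom1; exact: leq_maxl.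
by apply: dom2; exact: leq_maxr.
Qed.

(** Here [N], [M] stand for the integrals of a function over the two laws, and [u], [v] for those
    over their residual parts of mass [b]. *)
Let residual_arith (J b u v M N : \bar R) : 0 < b ->
  b \is a fin_num -> J \is a fin_num ->
  u \is a fin_num -> v \is a fin_num -> M \is a fin_num -> N \is a fin_num ->
  b * u <= b * v + J -> N + v = M + u -> N <= M + (fine J / fine b)%:E.
Proof.
case: b => [b| |]// b0 _; case: J => [J| |]// _; case: u => [u| |]// _.
case: v => [v| |]// _; case: M => [M| |]// _; case: N => [N| |]// _.
rewrite -!EFinM -!EFinD !lee_fin/= => leJ [eqNM].
have -> : N = (M + (u - v))%R by lra.
by rewrite lerD2l ler_pdivlMr//; nra.
Qed.

(* Splitting off the common part of [p n x] and [p n y] leaves measures [pp],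
   [qq] of mass [D n z], and only these contribute to the later gaps. *)
Lemma nstep_gap_residual n z : exists pp qq : {finite_measure set E -> \bar R},
  [/\ pp `<< p n z.1, qq `<< p n z.2, pp setT = D n z, qq setT = D n z &
    D n z * h z <= \int[pp \x qq]_w h w].
Proof.
have [pp [qq [pqE ppac qqac ppT qqT]]] := gap_jordan (p n z.1) (p n z.2).
exists pp, qq; split => //.
set b := D n z; rewrite -/(D n z) -/b in ppT qqT.
have bfin : b \is a fin_num by exact: gap_fin_num.
(* The case [b = 0] is trivial and is set apart because [b] is divided by below. *)
have : 0 <= b by exact: gap_ge0.
rewrite le_eqVlt => /predU1P[<-|b0].
  by rewrite mul0e integral_ge0// => w _; case/andP: (limit_gap01 P w).
have ppqqT : (pp \x qq) setT = b * b.
  rewrite -setXTT [LHS]product_measure1E//.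
  by congr (_ * _); [exact: ppT|exact: qqT].
(* The bound is proved with [D k] under the integral for each [k], using [h z <= D (n + k) z]; then
   [k] tends to infinity. *)
apply: (cvge_ge _ (cvg_integral_nstep_gap hE (m := pp \x qq) _)); last first.
  by rewrite [ltLHS]ppqqT ltey_eq fin_numM.
apply: nearW => k.
apply: (@le_trans _ _ (b * D (n + k) z)).
  by rewrite lee_pmul2l// limit_gap_le.
set J := \int[_]_w _.
have Jfin : J \is a fin_num.
  rewrite ge0_fin_numE; last first.
    by apply: integral_ge0 => w _; case/andP: (nstep_gap01 P k w).
  apply: (@le_lt_trans _ _ (\int[pp \x qq]_w 1)).
    apply: ge0_le_integral => //.
    - by move=> w _; case/andP: (nstep_gap01 P k w).
    - exact: measurable_nstep_gap.
    - by move=> w _; case/andP: (nstep_gap01 P k w).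
  by rewrite integral_cst// mul1e [ltLHS]ppqqT ltey_eq fin_numM.
suff : D (n + k) z <= (fine J / fine b)%:E.
  move=> Dle; apply: le_trans (lee_wpmul2l (ltW b0) Dle) _.
  rewrite -{1}(fineK bfin) -EFinM mulrCA divff ?mulr1 ?fineK//.
  by rewrite gt_eqF// fine_gt0// b0 ltey_eq bfin.
apply: gap_le => A mA; rewrite !nstepD//.
have mg := measurable_nstep P k mA.
have g01 x : 0 <= p k x A <= 1 by rewrite measure_ge0 probability_le1.
have g0 x : 0 <= p k x A by [].
have eqNM := integral_measure_eqD pqE mg g0.
have := le_integral_nstep_gap P hE pp qq k mA.
rewrite ppT qqT -/J => leJ.
apply: residual_arith b0 bfin Jfin _ _ _ _ leJ eqNM; exact: integral_le1_fin_num.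
Qed.

Variable mu : probability E R.
Hypothesis inv : invariant_probability P mu.

Lemma limit_gap_ae_eq0 : {ae mu \x mu, forall z, h z = 0}.
Proof.
pose f z := fine (h z).
have hfin z : h z \is a fin_num by exact: limit_gap_fin_num.
have fE z : (f z)%:E = h z by rewrite fineK.
have mh : measurable_fun [set: E * E] h by exact: measurable_limit_gap.
have h0 z : 0 <= h z by case/andP: (limit_gap01 P z).
have [z0 [fmu fQ]] : exists z0, {ae mu \x mu, forall z, f z = f z0} /\
    forall n, {ae nstep2 P n z0, forall w, f w = f z0}.
  apply: (@subharmonic_ae_cst _ _ _ (mu \x mu : probability _ R) (nstep2 P)).
  - by move=> n A; exact: measurable_nstep2.
  - by move=> n A; exact: invariant_nstep2.
  - exact: nstep2_dominates.
  - exact: measurableT_comp mh.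
  - by move=> z; rewrite -!lee_fin fE limit_gap01.
  - move=> n z; under eq_integral do rewrite fE.
    by rewrite fE limit_gap_subharmonic.
suff hz0 : h z0 = 0.
  by apply: filterS fmu => z fz; rewrite -fE fz fE.
apply: contrapT => /eqP hz0; have {}hz0 : 0 < h z0 by rewrite lt_neqAle eq_sym hz0 h0.
(* With [c = h z0 > 0] and [b = D n z0 > 0], cancelling [b * c] in [b * c <= c * b ^ 2] gives
   [1 <= b] for every [n], against [c < 1]. *)
suff D1 n : 1 <= D n z0.
  have := limit_gap_lt1 z0; rewrite ltNge => /negP; apply.
  by apply: le_ereal_inf_tmp => _ [n _ <-]; exact: D1.
have b0 : 0 < D n z0 by exact: lt_le_trans hz0 (limit_gap_le P n z0).
have bfin : D n z0 \is a fin_num by exact: gap_fin_num.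
have [pp [qq [ppac qqac ppT qqT]]] := nstep_gap_residual n z0.
have ac : pp \x qq `<< nstep2 P n z0 by exact: product_dominates.
(* The residual product is dominated by [nstep2 P n z0], under which [h] is almost surely [h z0]. *)
rewrite (_ : \int[_]_w _ = \int[pp \x qq]_w h z0); last first.
  apply: ge0_ae_eq_integral => //.
  apply: filterS (null_dominates_ae ac (fQ n)) => w fw _.
  by rewrite -[LHS]fE fw fE.
have ppqqT : (pp \x qq) setT = D n z0 * D n z0.
  rewrite -setXTT [LHS]product_measure1E//.
  by congr (_ * _); [exact: ppT|exact: qqT].
rewrite integral_cst// [X in _ <= _ * X]ppqqT muleCA lee_pmul2l//.
by rewrite -[leLHS]mule1 lee_pmul2l.
Qed.

(** Otherwise each [p n x] charges some [mu]-null set [A n]. By invariance some [y] has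
    [p n y (A n) = 0] for all [n] simultaneously, which is contradicted at a time when [p n x] is
    dominated by [p n y]. *)
Lemma dominated_by_invariant x : exists n, p n x `<< mu.
Proof.
apply: contrapT => /forallNP nac.
have /choice[A AP] n : exists A, [/\ measurable A, mu A = 0 & p n x A != 0].
  apply: contrapT => /forallNP nA; apply: (nac n).
  apply/null_content_dominatesP => A mA muA0.
  by apply: contrapT => /eqP pA0; apply: (nA A).
have : {ae mu, forall y n, p n y (A n) = 0}.
  apply: ae_foralln => n; have [mA muA0 _] := AP n.
  apply/(ge0_integral_eq0P _ (measurable_nstep P n mA)) => //.
  by rewrite -invariant_nstep.
move=> /ae_probability_ex[y yA].
have [n dom] := nstep_eventually_dominates x y.
have [mA _ /eqP] := AP n; apply.
by have /null_content_dominatesP := dom n (leqnn n); apply => //; exact: yA.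
Qed.

Lemma limit_gap_eq0 z : h z = 0.
Proof.
have [n1 ac1] := dominated_by_invariant z.1.
have [n2 ac2] := dominated_by_invariant z.2.
pose n := maxn n1 n2.
have ac : nstep2 P n z `<< mu \x mu.
  apply: product_dominates.
    exact: (invariant_dominates_le (leq_maxl _ _) inv ac1).
  exact: (invariant_dominates_le (leq_maxr _ _) inv ac2).
have h0 w : 0 <= h w by case/andP: (limit_gap01 P w).
apply/eqP; rewrite eq_le h0 andbT.
rewrite (le_trans (limit_gap_subharmonic P hE n z))//.
rewrite (ge0_integral_eq0P _ (measurable_limit_gap P hE) h0).2//.
exact: null_dominates_ae ac limit_gap_ae_eq0.
Qed.

Lemma cvg_integral_gap_fst x :
  \int[mu]_y D n (x, y) @[n --> \oo] --> 0.
Proof.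
rewrite [X in _ --> X](_ : _ = \int[mu]_y (fun=> 0) y); last first.
  by rewrite integral0.
apply: (@dominated_cvg _ _ _ mu _ measurableT (fun n y => D n (x, y)) _ (cst 1)) => //.
- by move=> n; exact: (measurableT_comp (measurable_nstep_gap P hE n)).
- by move=> y _; rewrite -(limit_gap_eq0 (x, y)); exact: cvg_nstep_gap.
- exact: finite_measure_integrable_cst.
- by move=> n y _; case/andP: (nstep_gap01 P n (x, y)) => D0 D1; rewrite gee0_abs.
Qed.

Lemma cvg_gap_invariant x : gap (p n x) mu @[n --> \oo] --> 0.
Proof.
apply: (@squeeze_cvge _ _ _ _ (cst 0) _ (fun n => \int[mu]_y D n (x, y))); last 2 first.
- exact: cvg_cst.
- exact: cvg_integral_gap_fst.
(* Since [mu] is the [mu]-average of the laws [p n y], its gap to [p n x] is at most the average of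
   the gaps. *)
apply: nearW => n; rewrite gap_ge0/=; apply: gap_le => A mA.
rewrite (invariant_nstep n inv mA).
have mp := measurable_nstep P n mA.
have mD : measurable_fun [set: E] (fun y => D n (x, y)).
  exact: (measurableT_comp (measurable_nstep_gap P hE n)).
rewrite -ge0_integralD//; last by move=> y _; exact: gap_ge0.
rewrite -[leLHS]mule1 -(probability_setT mu) -integral_cst//.
apply: ge0_le_integral => //; first exact: emeasurable_funD.
by move=> y _; exact: le_gap.
Qed.

End doob.

Theorem theorem1 (R : realType) (d : measure_display) (E : measurableType d)
  (hE : countably_generated E)
  (hdiag : measurable (diagonal : set (E * E)))
  (P : R.-pker E ~> E)
  (hP : forall x y : E, exists n : nat, (0 < n)%N /\
      equivalent_measures (nstep P n x) (nstep P n y)) :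
  (forall mu mu' : probability E R,
      invariant_probability P mu -> invariant_probability P mu' ->
      forall A : set E, measurable A -> mu A = mu' A) /\
  (forall mu : probability E R, invariant_probability P mu ->
      forall x : E,
        tv_dist (nstep_probability P n x) mu @[n --> \oo] --> 0).
Proof.
split.
  have le (mu mu' : probability E R) : invariant_probability P mu ->
      invariant_probability P mu' -> forall A, measurable A -> mu A <= mu' A.
    move=> inv inv' A mA.
    (* The existence of a probability measure provides a starting point [x]; the law of the chain
       from [x] approaches both invariant measures. *)
    have [x _] := @ae_probability_ex _ _ _ mu (fun=> True) (aeW _ (fun=> I)).
    have c1 := cvg_gap_invariant hE hP inv x.
    have c2 := cvg_gap_invariant hE hP inv' x.
    pose q n := nstep_probability P n x.
    have c : mu' A + (gap (q n) mu' + gap (q n) mu) @[n --> \oo] --> mu' A + (0 + 0).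
      apply: cvgeD; [by rewrite !adde0 fin_num_adde_defl|exact: cvg_cst|].
      by apply: cvgeD; [rewrite fin_num_adde_defl|exact: c2|exact: c1].
    rewrite -[leRHS]adde0 -[X in _ + X]adde0.
    apply: (cvge_ge _ c); apply: nearW => n.
    apply: le_trans (le_gap mu (q n) mA) _.
    by rewrite addeA gapC leeD2r// le_gap.
  by move=> mu mu' inv inv' A mA; apply/eqP; rewrite eq_le !le.
move=> mu inv x; rewrite [X in _ --> X](_ : 0 = 2%:E * 0); last by rewrite mule0.
under eq_fun do rewrite tv_dist_gap.
by apply: cvgeZl => //; exact: cvg_gap_invariant.
Qed.
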